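(* Let $n\ge 1$ and $t\ge 1$ be integers, let $G=K_t^n$ be the $n$-dimensional complete grid, and let $q\ge 0$ be an even integer with $q\le \lfloor \frac{t}{6}\rfloor-1$. Let $D=(V(D),E(D))$ be a demand graph with $V(D)=V(K_t^n)$ and $\Delta(D)\le q$. Then every edge $e\in E(D)$ can be assigned a path $P_e$ in $G$ joining the two endpoints of $e$ such that the paths $P_e$ ($e\in E(D)$) are pairwise edge-disjoint.
   Context: The $n$-dimensional complete grid $K_t^n = K_t\square\cdots\square K_t$ is the Cartesian product of $n$ copies of the complete graph $K_t$: its vertex set is $\{1,\dots,t\}^n$, and two vertices are adjacent if and only if they differ in exactly one coordinate. A demand graph $D$ on the vertex set of $G$ is a finite multigraph (parallel edges are allowed and counted with multiplicity; each edge joins two distinct vertices) on the vertex set $V(G)$; its edges are not required to be edges of $G$. $\Delta(D)$ denotes the maximum degree of $D$, where degrees count edges with multiplicity. The paths assigned to distinct edges of $D$ (including parallel ones) must be edge-disjoint as subgraphs of $G$. *)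

(* Defs.v *)
From mathcomp Require Import all_boot.

Set Implicit Arguments.
Unset Strict Implicit.
Unset Printing Implicit Defensive.

(* Coordinates range over 0, ..., t-1 rather than 1, ..., t. *)
Definition grid_vertex (n t : nat) : finType := {ffun 'I_n -> 'I_t}.

Definition grid_adj (n t : nat) : rel (grid_vertex n t) :=
  fun x y => #|[set i | x i != y i]| == 1.

(* Parallel edges are distinct elements of [edge] with the same [ends]. *)
Record multigraph (V : finType) := Multigraph {
  edge : finType;
  ends : edge -> {set V};
  card_ends : forall e : edge, #|ends e| = 2
}.

Definition degree (V : finType) (D : multigraph V) (v : V) : nat :=
  #|[set e : edge D | v \in ends e]|.

Definition max_degree (V : finType) (D : multigraph V) : nat :=
  \max_(v : V) degree D v.

(* A path is given by its sequence of vertices, which are pairwise distinct;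
   it joins the two elements of S when these are its first and last vertices. *)
Definition path_joining (V : finType) (adj : rel V) (S : {set V})
    (s : seq V) : Prop :=
  exists x p, [/\ s = x :: p, path adj x p, uniq s & S = [set x; last x p]].

Definition path_edges (V : finType) (s : seq V) : {set {set V}} :=
  [set [set a.1; a.2] | a in zip s (behead s)].

(* Main.v *)
Require Import Defs.
From mathcomp Require Import all_boot.
From mathcomp Require Import fingroup perm zify.

Set Implicit Arguments.
Unset Strict Implicit.
Unset Printing Implicit Defensive.

(** Complete graphs: if a demand graph on K_t has maximum degree at most 2k and
    t >= 6k+6, it can be routed. By Petersen's theorem it splits into k
    2-factors; delete six vertices (two triples W1 and W2 of hubs) and route as
    follows. The first 2-factor gets a balanced proper 3-edge-colouring, and its
    edges of colour a are routed through the a-th vertex of W1. The second one is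
    treated in the same way with W2, except at W1. A vertex u outside the hubs
    sees only two of the three colours of a 2-factor, so one of its edges to each
    triple is left over; these are used to move the remaining demands at the hubs
    to distinct vertices outside the hubs. Each vertex loses degree 4 and gains at
    most 2, so induction applies to t - 6 vertices and degree 2(k - 1).

    Grids: project the demands to K_t^(n-1), split the resulting graph of degree
    at most qt into qt/2 2-factors, and assign them in groups of q/2 to the t
    layers. Each demand moves along the last coordinate to its layer, is routed in
    that layer by induction, and then moves to its end along the last coordinate.
    Every column carries a demand graph of degree at most 2q, so the case of
    complete graphs applies with k = q. *)

(** * Factorization of multigraphs *)

Lemma inj_on_exists (A B : finType) (b0 : B) (S : {set A}) (T : {set B}) :
  #|S| <= #|T| ->
  exists f : A -> B, {in S &, injective f} /\ {in S, forall x, f x \in T}.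
Proof.
move=> leST; exists (fun x => nth b0 (enum T) (index x (enum S))).
have lt_ix x : x \in S -> index x (enum S) < size (enum T).
  by move=> xS; rewrite -cardE (leq_trans _ leST) // cardE index_mem mem_enum.
split=> [x y xS yS /eqP | x xS]; last by rewrite -mem_enum mem_nth ?lt_ix.
rewrite nth_uniq ?enum_uniq ?lt_ix // => /eqP /(congr1 (nth x (enum S))).
by rewrite !nth_index ?mem_enum.
Qed.

(** * Hall's marriage theorem *)

Section Hall.
Variables (A B : finType) (r : A -> B -> bool).

Let nbr (T : {set B}) (S : {set A}) := [set y in T | [exists x in S, r x y]].

(** Induction on [#|S|]. A tight nonempty proper subset is matched into its own neighbourhood, and
    the condition survives for the rest. Without such a subset every nonempty proper subset has a
    neighbour to spare, so an arbitrary first pair can be removed. Working inside [S] and [T] keeps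
    the types fixed. *)
Lemma hall_within (b0 : B) (S : {set A}) (T : {set B}) :
    (forall S' : {set A}, S' \subset S -> #|S'| <= #|nbr T S'|) ->
  exists f : A -> B,
    {in S &, injective f} /\ {in S, forall x, (f x \in T) && r x (f x)}.
Proof.
have [n] := ubnP #|S|; elim: n => // n IHn in S T *; rewrite ltnS => leSn hallS.
have [->|[x0 x0S]] := set_0Vmem S.
  by exists (fun=> b0); split=> x; rewrite ?inE // => y; rewrite inE.
have [/exists_inP[S1 S1S /and3P[S1n0 S1S' tight]]|notight] :=
  boolP [exists S1 in powerset S,
          [&& S1 != set0, S1 != S & #|S1| == #|nbr T S1|]].
- rewrite inE in S1S; have pS1 : S1 \proper S by rewrite properEneq S1S'.
  have [||f1 [f1I f1r]] := IHn S1 T.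
  + exact: leq_trans (proper_card pS1) leSn.
  + by move=> S' S'S1; apply/hallS/(subset_trans S'S1).
  have [||f2 [f2I f2r]] := IHn (S :\: S1) (T :\: nbr T S1).
  + apply: leq_trans leSn; rewrite cardsD (setIidPr S1S).
    have := subset_leq_card S1S; rewrite -card_gt0 in S1n0; lia.
  + move=> S' /subsetDP[S'S dS'].
    have /hallS : S' :|: S1 \subset S by rewrite subUset S'S.
    rewrite cardsU (eqP (_ : S' :&: S1 == set0)) ?setI_eq0 // cards0 subn0.
    rewrite (eqP tight) => le1.
    have sub : nbr T (S' :|: S1) \subset nbr (T :\: nbr T S1) S' :|: nbr T S1.
      apply/subsetP=> y; rewrite !inE => /andP[-> /exists_inP[x xU rxy]] /=.
      have [//|no /=] := boolP [exists x in S1, r x y]; rewrite ?orbT ?orbF //.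
      have xS1 : x \notin S1 by apply: contra no => xS1; apply/exists_inP; exists x.
      by apply/exists_inP; exists x => //; move: xU; rewrite inE (negPf xS1) orbF.
    have := leq_trans (subset_leq_card sub) (leq_card_setU _ _).1; lia.
  exists (fun x => if x \in S1 then f1 x else f2 x); split=> [x y xS yS|x xS].
    have sep u v : u \in S1 -> v \in S -> v \notin S1 -> f1 u = f2 v -> u = v.
      move=> uS1 vS vS1 eq12; have vD : v \in S :\: S1 by rewrite inE vS1.
      have /andP[] := f2r v vD; rewrite !inE -eq12.
      have /andP[-> ru] := f1r u uS1; case/andP=> /negP[] /=.
      by apply/exists_inP; exists u.
    case: ifPn => xS1; case: ifPn => yS1; first exact: f1I.
    - exact: sep.
    - by move=> /esym /sep ->.
    by apply: f2I; rewrite inE ?xS1 ?yS1.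
  case: ifPn => xS1; first exact: f1r.
  have /f2r : x \in S :\: S1 by rewrite inE xS1.
  by case/andP; rewrite inE => /andP[_ ->].
have [y0] : exists y0, y0 \in nbr T [set x0].
  by apply/card_gt0P; rewrite (leq_trans _ (hallS _ _)) ?cards1 ?sub1set.
rewrite inE => /andP[y0T /exists_inP[_ /set1P-> rxy0]].
have [||f [fI fr]] := IHn (S :\ x0) (T :\ y0).
- by move: leSn; rewrite (cardsD1 x0 S) x0S.
- move=> S' S'S; have [->|S'n0] := eqVneq S' set0; first by rewrite cards0.
  have S'S0 : S' \subset S := subset_trans S'S (subsetDl _ _).
  have ltS' : #|S'| < #|nbr T S'|.
    rewrite ltn_neqAle hallS // andbT; apply: contra notight => tight.
    apply/exists_inP; exists S'; rewrite ?inE // S'n0 tight andbT.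
    by apply: contraL S'S => /eqP ->; apply/subsetPn; exists x0; rewrite // !inE eqxx.
  have : nbr T S' \subset nbr (T :\ y0) S' :|: [set y0].
    by apply/subsetP=> y; rewrite !inE; case: eqP => //= _; rewrite orbF.
  move/subset_leq_card/leq_trans/(_ (leq_card_setU _ _).1); rewrite cards1; lia.
exists (fun x => if x == x0 then y0 else f x); split=> [x y xS yS|x xS].
  have sep u : u \in S -> u != x0 -> f u <> y0.
    by move=> uS nu eqf; have := fr u; rewrite !inE uS nu eqf eqxx => /(_ isT).
  case: eqVneq => [->|nx]; case: eqVneq => [->|ny] //.
  - by move=> /esym /(sep _ yS ny).
  - by move=> /(sep _ xS nx).
  by apply: fI; rewrite !inE ?nx ?ny.
case: eqVneq => [->|nx]; first by rewrite y0T.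
by have := fr x; rewrite !inE nx xS => /(_ isT) /andP[/andP[_ ->]].
Qed.

Lemma hall :
    (forall S : {set A}, #|S| <= #|[set y | [exists x in S, r x y]]|) ->
  exists f : A -> B, injective f /\ forall x, r x (f x).
Proof.
move=> hallA; have [A0|[x0 _]] := set_0Vmem [set: A].
  have noA (x : A) : False by have := in_setT x; rewrite A0 inE.
  by exists (fun x => match noA x with end); split=> x; case: (noA x).
have /card_gt0P[b0 _] : 0 < #|[set y | [exists x in [set x0], r x y]]|.
  by rewrite (leq_trans _ (hallA _)) ?cards1.
have [|f [fI fr]] := @hall_within b0 setT setT.
  move=> S _; apply: leq_trans (hallA S) _.
  by apply/subset_leq_card/subsetP=> y; rewrite !inE.
by exists f; split=> [x y|x]; [apply: fI | have /andP[] := fr x (in_setT x)].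
Qed.
End Hall.

(** * Regular bipartite graphs and Petersen's theorem *)

Lemma card_fiber_sum (F V : finType) (s : F -> V) (B : {set F}) (S : {set V}) :
  #|[set e in B | s e \in S]| = \sum_(v in S) #|[set e in B | s e == v]|.
Proof.
rewrite -sum1_card (partition_big s (mem S)) /=; last first.
  by move=> e; rewrite inE => /andP[].
apply: eq_bigr => v vS; rewrite -sum1_card; apply: eq_bigl => e.
by rewrite !inE; case: eqP => [->|]; rewrite ?vS ?andbT ?andbF.
Qed.

Lemma card_fiber_sumT (F V : finType) (s : F -> V) (S : {set V}) :
  #|[set e | s e \in S]| = \sum_(v in S) #|[set e | s e == v]|.
Proof.
have := card_fiber_sum s setT S.
rewrite (_ : [set e in _ | _] = [set e | s e \in S]); last by apply/setP=> e; rewrite !inE.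
by move=> ->; apply: eq_bigr => v _; apply: eq_card => e; rewrite !inE.
Qed.

(** König's theorem, by removing perfect matchings. Hall's condition holds by double counting: [S]
    emits [k.+1] edges per vertex, and a vertex on the other side absorbs no more than that. The
    matching [M] gets the colour [k]. *)
Lemma bipartite_factorization (V F : finType) (s d : F -> V) k (B : {set F}) :
    (forall v, #|[set e in B | s e == v]| = k) ->
    (forall v, #|[set e in B | d e == v]| = k) ->
  exists c : F -> nat,
    [/\ {in B, forall e, c e < k},
        {in B &, forall e f, c e = c f -> s e = s f -> e = f} &
        {in B &, forall e f, c e = c f -> d e = d f -> e = f}].
Proof.
elim: k => [|k IHk] in B * => sB dB.
  have noB e : e \notin B.
    apply/negP => eB; have := sB (s e); apply/eqP; rewrite -lt0n.
    by apply/card_gt0P; exists e; rewrite inE eB /=.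
  by exists (fun=> 0); split=> e /=; rewrite (negPf (noB e)).
have [|f [fI fr]] := @hall V V (fun v w => [exists e in B, (s e == v) && (d e == w)]).
  move=> S; rewrite -(leq_pmul2r (ltn0Sn k)) -!sum_nat_const.
  rewrite -(eq_bigr _ (fun v _ => sB v)) -[X in _ <= X](eq_bigr _ (fun v _ => dB v)).
  rewrite -!card_fiber_sum; apply/subset_leq_card/subsetP=> e; rewrite !inE.
  case/andP=> eB seS; rewrite eB; apply/exists_inP; exists (s e) => //.
  by apply/exists_inP; exists e; rewrite ?eqxx.
have /fin_all_exists[m mP] v : exists e, [/\ e \in B, s e = v & d e = f v].
  by have /exists_inP[e eB /andP[/eqP se /eqP de]] := fr v; exists e.
pose M := [set m v | v in [set: V]].
have mM v : m v \in M by apply: imset_f.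
have MP e : e \in M -> e = m (s e).
  by case/imsetP=> v _ ->; have [_ -> _] := mP v.
have [||c [ck cs cd]] := IHk (B :\: M).
- move=> v; have := sB v; rewrite (cardsD1 (m v)) !inE.
  have [-> -> _] := mP v; rewrite eqxx => -[<-]; apply: eq_card => e; rewrite !inE.
  case: (boolP (e \in M)) => [/MP-> /=|eM /=].
    have [_ sm _] := mP (s e); rewrite sm; by case: (eqVneq (s e) v) => [<-|]; rewrite ?eqxx ?andbF.
  by case: (eqVneq e (m v)) => [e_m|] //; rewrite e_m mM in eM.
- move=> w; have [g _ gK] := injF_bij fI; have := dB w.
  rewrite (cardsD1 (m (g w))) !inE; have [-> _ ->] := mP (g w).
  rewrite gK eqxx => -[<-]; apply: eq_card => e; rewrite !inE.
  case: (boolP (e \in M)) => [/MP-> /=|eM /=].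
    have [_ _ ->] := mP (s e); case: (eqVneq (f (s e)) w) => [<-|]; rewrite ?andbF //.
    suff -> : g (f (s e)) = s e by rewrite eqxx.
    by apply: fI; rewrite gK.
  by case: (eqVneq e (m (g w))) => [e_m|] //; rewrite e_m mM in eM.
exists (fun e => if e \in M then k else c e).
have lt_ck e : e \in B -> e \notin M -> c e < k.
  by move=> eB eM; apply: ck; rewrite inE eM.
split=> [e eB|e e' eB e'B|e e' eB e'B].
- by case: ifPn => // eM; rewrite ltnW ?ltnS ?lt_ck.
- case: ifPn => eM; case: ifPn => e'M.
  + by move=> _ seq; rewrite (MP _ eM) (MP _ e'M) seq.
  + by move=> ck_eq; have := lt_ck _ e'B e'M; rewrite -ck_eq ltnn.
  + by move=> ck_eq; have := lt_ck _ eB eM; rewrite ck_eq ltnn.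
  by apply: cs; rewrite inE ?eM ?e'M.
case: ifPn => eM; case: ifPn => e'M.
- rewrite (MP _ eM) (MP _ e'M) => _.
  by have [_ _ ->] := mP (s e); have [_ _ ->] := mP (s e') => /fI ->.
- by move=> ck_eq; have := lt_ck _ e'B e'M; rewrite -ck_eq ltnn.
- by move=> ck_eq; have := lt_ck _ eB eM; rewrite ck_eq ltnn.
by apply: cd; rewrite inE ?eM ?e'M.
Qed.

(** Counting ends rather than edges makes a loop contribute 2 to the degree. *)
Definition half_edges (V E : finType) (p : E * bool -> V) (v : V) :=
  [set h | p h == v].

(* Hall's theorem lets each vertex choose k of its edges as outgoing; in a
   2k-regular graph the other half-edges are then k incoming ones. *)
Lemma eulerian_orientation (V F : finType) (p : F * bool -> V) k :
    (forall v, #|half_edges p v| = k.*2) ->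
  exists o : F -> bool,
    forall v, #|[set e | p (e, o e) == v]| = k /\
              #|[set e | p (e, ~~ o e) == v]| = k.
Proof.
move=> deg; have reg v : #|[set h | p h == v]| = k.*2 := deg v.
have card_half (S : {set F}) : #|[set h : F * bool | h.1 \in S]| = #|S|.*2.
  rewrite (_ : [set h | _] = setX S setT); first by rewrite cardsX cardsT card_bool muln2.
  by apply/setP=> -[e b]; rewrite !inE andbT.
have cardF : #|F| = (k * #|V|)%N.
  apply: double_inj; rewrite -[#|F|]cardsT -card_half doubleMl mulnC -[#|V|]cardsT.
  rewrite -sum_nat_const -(eq_bigr _ (fun v _ => reg v)).
  rewrite -card_fiber_sumT; by apply: eq_card => h; rewrite !inE.
(* Every vertex offers [k] slots. The [#|S|.*2] half-edges of [S] all lie at vertices of [T], which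
   carry [k.*2] each; this is Hall's condition. *)
have [|f [fI fr]] := @hall F (V * 'I_k)%type
    (fun e x => (p (e, true) == x.1) || (p (e, false) == x.1)).
  move=> S; rewrite -leq_double -card_half.
  pose T := [set v | [exists e in S, (p (e, true) == v) || (p (e, false) == v)]].
  rewrite (_ : [set y | _] = setX T setT); last first.
    by apply/setP=> -[v i]; rewrite !inE andbT.
  rewrite cardsX cardsT card_ord doubleMr -sum_nat_const.
  rewrite -(eq_bigr _ (fun v _ => reg v)).
  rewrite -card_fiber_sumT; apply/subset_leq_card/subsetP=> -[e b]; rewrite !inE /= => eS.
  by apply/exists_inP; exists e => //; case: b; rewrite eqxx ?orbT.
exists (fun e => p (e, true) == (f e).1) => v.
have po e : p (e, p (e, true) == (f e).1) = (f e).1.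
  by have := fr e; case: (eqVneq (p (e, true))) => [->|_ /= /eqP].
have out : #|[set e | p (e, p (e, true) == (f e).1) == v]| = k.
  have fB : bijective f by apply: inj_card_bij; rewrite // card_prod card_ord cardF mulnC.
  have [g fK gK] := fB.
  rewrite -[RHS]card_ord -cardsT -(card_imset setT (_ : injective (fun i => g (v, i)))).
    apply: eq_card => e; rewrite inE po; apply/eqP/imsetP=> [<-|[i _ ->]].
      by exists (f e).2; rewrite ?inE // -surjective_pairing fK.
    by rewrite gK.
  by move=> i j /(can_inj gK)[].
split=> //; apply/eqP; rewrite -(eqn_add2l k) -[X in X + _]out addnn -(reg v).
pose o e := p (e, true) == (f e).1.
rewrite -(card_imset _ (_ : injective (fun e => (e, o e)))); last by move=> ? ? [].
rewrite -[X in _ + X](card_imset _ (_ : injective (fun e => (e, ~~ o e)))); last by move=> ? ? [].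
rewrite -cardsUI (_ : _ :&: _ = set0) ?cards0 ?addn0; last first.
  apply/setP=> h; rewrite !inE; apply/negP=> /andP[/imsetP[e _ ->] /imsetP[e' _ []]].
  by move=> -> ; case: (o e').
apply/eqP/eq_card=> -[e b]; rewrite !inE; apply/orP/eqP=> [[]/imsetP[e']|<-].
- by rewrite inE => /eqP <- [-> ->].
- by rewrite inE => /eqP <- [-> ->].
case: (eqVneq b (o e)) => [->|bo]; [left|right]; apply/imsetP; exists e.
- by rewrite inE.
- by [].
- by rewrite inE -/(o e); move: bo; case: b; case: (o e).
by move: bo; case: b; case: (o e).
Qed.

Lemma two_factorization (V E : finType) (p : E * bool -> V) k :
    (forall v, #|half_edges p v| <= k.*2) ->
  exists (c : E -> nat) (o : E -> bool),
    [/\ forall e, c e < k,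
        forall e f, c e = c f -> p (e, o e) = p (f, o f) -> e = f &
        forall e f, c e = c f -> p (e, ~~ o e) = p (f, ~~ o f) -> e = f].
Proof.
(* Two copies of the graph, joined by parallel edges between the two copies of
   each deficient vertex, form a 2k-regular graph. *)
move=> deg_le.
pose X := {v : V & 'I_(k.*2 - #|half_edges p v|)}.
pose F := (E * bool + X)%type.
pose q (h : F * bool) : V * bool :=
  match h.1 with inl x => (p (x.1, h.2), x.2) | inr x => (tag x, h.2) end.
have reg x : #|half_edges q x| = k.*2.
  case: x => v i.
  pose fE (h : E * bool) : F * bool := (inl (h.1, i), h.2).
  pose fX (j : 'I_(k.*2 - #|half_edges p v|)) : F * bool := (inr (Tagged _ j), i).
  have fEI : injective fE by move=> [e b] [e' b'] [-> ->].
  have fXI : injective fX.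
    by move=> j j' [] /eqP; rewrite -tag_eqE /tag_eq eqxx tagged_asE => /eqP.
  have cardX : #|fX @: setT| = k.*2 - #|half_edges p v|.
    by rewrite card_imset // cardsT card_ord.
  have cardE : #|fE @: half_edges p v| = #|half_edges p v| by rewrite card_imset.
  rewrite -[RHS](subnKC (deg_le v)) -[X in _ = X + _]cardE -cardX.
  rewrite -cardsUI (_ : _ :&: _ = set0) ?cards0 ?addn0.
    apply: eq_card => -[[[e i']|x] b]; rewrite !inE /q /=; apply/eqP/orP.
    - move=> [pv ->]; left; apply/imsetP; exists (e, b) => //.
      by rewrite inE pv.
    - by case=> /imsetP[[e' b']] //; rewrite inE => /eqP <- [-> -> ->].
    - case: x => v' j /= [vv' ->]; right; subst v'.
      by apply/imsetP; exists j.
    by case=> /imsetP[? _ []] // -> ->.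
  apply/setP=> -[f b]; rewrite !inE; apply/negP.
  by case/andP=> /imsetP[? _ [-> _]] /imsetP[? _ []].
have [o oP] := eulerian_orientation reg.
(* Tails and heads are the two sides of a [k]-regular bipartite graph; a perfect matching in it is a
   2-factor. *)
have [||c [ck cs cd]] := @bipartite_factorization _ F (fun e => q (e, o e))
                          (fun e => q (e, ~~ o e)) k setT.
- by move=> v; rewrite -[RHS](oP v).1; apply: eq_card => e; rewrite !inE.
- by move=> v; rewrite -[RHS](oP v).2; apply: eq_card => e; rewrite !inE.
pose copy e : F := inl (e, false).
exists (c \o copy), (o \o copy); split=> [e|e f /= cef pef|e f /= cef pef].
- exact: ck.
- by have [] : copy e = copy f by apply: cs; rewrite ?inE // /q /= pef.
by have [] : copy e = copy f by apply: cd; rewrite ?inE // /q /= pef.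
Qed.

(** The sets of tails and of heads have complements of equal size, so the partial injection extends.
    A factor thereby becomes part of the cycles of a permutation. *)
Lemma perm_of_arcs (V E : finType) (S : {set E}) (s d : E -> V) :
    {in S &, injective s} -> {in S &, injective d} ->
  exists pi : {perm V}, {in S, forall e, pi (s e) = d e}.
Proof.
move=> sI dI; have [S0|[e0 e0S]] := set_0Vmem S.
  by exists 1%g => e; rewrite S0 inE.
have [|f [fI fD]] := @inj_on_exists V V (s e0) (~: (s @: S)) (~: (d @: S)).
  by have := cardsC (s @: S); have := cardsC (d @: S); rewrite !card_in_imset //; lia.
pose g v := if [pick e in S | s e == v] is Some e then d e else f v.
have gS e : e \in S -> g (s e) = d e.
  move=> eS; rewrite /g; case: pickP => [e' /andP[e'S /eqP/sI->]//|/(_ e)].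
  by rewrite eS eqxx.
have gC v : v \notin s @: S -> g v = f v.
  move=> vS; rewrite /g; case: pickP => // e /andP[eS /eqP sev].
  by rewrite -sev imset_f in vS.
have sep e v : e \in S -> v \notin s @: S -> d e != f v.
  move=> eS vS; have := fD v; rewrite !inE vS => /(_ isT).
  by apply: contra => /eqP <-; apply: imset_f.
have gI : injective g.
  move=> u v; have [/imsetP[e eS ->]|uS] := boolP (u \in s @: S);
    have [/imsetP[e' e'S ->]|vS] := boolP (v \in s @: S); rewrite ?gS ?gC //.
  - by move=> /dI ->.
  - by move/eqP; rewrite (negPf (sep _ _ _ _)).
  - by move/esym/eqP; rewrite (negPf (sep _ _ _ _)).
  by apply: fI; rewrite inE.
by exists (perm gI) => e eS; rewrite permE gS.
Qed.

(** * Balanced 3-edge-colourings of 2-factors *)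

(** The slack 2 is forced by a cycle of length 2, whose two vertices miss the same colour. *)
Definition balanced (N : 'I_3 -> nat) := forall a b, N a <= N b + 2.

Lemma ord3_third (x y : 'I_3) : x != y -> exists z,
  [/\ z != x, z != y & forall a : 'I_3, (z == a) + (x == a) + (y == a) = 1].
Proof.
move=> xy; have [z] : exists z, z \in ~: [set x; y].
  by apply/card_gt0P; rewrite cardsCs setCK cards2 xy card_ord.
rewrite !inE negb_or => /andP[zx zy]; exists z; split=> // a.
have : a \in [set z; x; y].
  suff /eqP-> : [set z; x; y] == setT by rewrite inE.
  rewrite eqEcard subsetT cardsT card_ord -setUA cardsU1 cards2.
  by rewrite !inE negb_or zx zy xy.
rewrite !inE => /orP[/orP[]|] /eqP ->; rewrite eqxx;
  rewrite ?(negPf zx) ?(negPf zy) ?(negPf xy) //;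
  by rewrite ?(eq_sym x) ?(eq_sym y) ?(negPf zx) ?(negPf zy) ?(negPf xy) // (eq_sym y) (negPf xy).
Qed.

(* [c i] is the colour of the i-th edge of a cycle of length L, and [g i] is the
   colour missing at its tail. A cycle is extended by three edges without
   affecting the differences between the colour counts. *)
Lemma balanced_cycle_pattern L (N : 'I_3 -> nat) : 0 < L -> balanced N ->
  exists c g : nat -> 'I_3,
    (1 < L -> forall i, i < L ->
      [/\ c i != c (i.+1 %% L), g i != c i & g (i.+1 %% L) != c i]) /\
    balanced (fun a => N a + \sum_(i < L) (g i == a)).
Proof.
have [n] := ubnP L; elim: n => // n IHn in L *; rewrite ltnS => leLn L_gt0 balN.
(* Length 4 is a base case: a pattern of length 1 satisfies no constraint that could be extended. *)
have [L_gt4|L_le4] := ltnP 4 L.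
  have [| | |c [g [cgP bal]]] := IHn (L - 3); [lia|lia|by []|].
  have L3 : 1 < L - 3 by lia.
  have {}cgP := cgP L3; set M := L - 3 in cgP bal L3 *.
  have [c_last g0_c0 g0_last] : [/\ c M.-1 != c 0, g 0 != c 0 & g 0 != c M.-1].
    have [] := cgP M.-1; first by lia.
    rewrite prednK ?modnn; last lia.
    by move=> ? _ ?; split=> //; have [] := cgP 0; lia.
  have third (a : 'I_3) : (g 0 == a) + (c M.-1 == a) + (c 0 == a) = 1.
    have [z [zx zy zP]] := ord3_third c_last.
    suff -> : g 0 = z by [].
    have := zP (g 0); rewrite !(eq_sym _ (g 0)) (negPf g0_c0) (negPf g0_last).
    by case: eqP.
  have eqL : L = M.+3 by rewrite /M; lia.
  have F1 : (M.+1 < M) = false by lia.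
  have F2 : (M.+2 < M) = false by lia.
  have S2 : M.+2 - M = 2 by lia.
  (* The colours run [c M.-1], [c 0], [g 0], [c M.-1], [c 0] across the insertion, so each of the
     three colours is missing at exactly one new tail. *)
  exists (fun i => if i < M then c i else nth (c 0) [:: c 0; g 0; c M.-1] (i - M)).
  exists (fun i => if i < M then g i else nth (c 0) [:: g 0; c M.-1; c 0] (i - M)).
  rewrite eqL; split=> [_ i ltiM|a b].
    have [iM|leMi] := ltnP i M.
      have [iM1|] := ltnP i.+1 M.
        by have := cgP i iM; rewrite !modn_small ?iM1 //; lia.
      move=> leMi; have eiM : i = M.-1 by lia.
      have -> : i.+1 %% M.+3 = M by rewrite modn_small; lia.
      rewrite ltnn subnn /= eiM; split=> //.
      have [|_ gc _] := cgP M.-1; [lia|by []].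
    have [->|[->|->]] : i = M \/ i = M.+1 \/ i = M.+2 by lia.
    - rewrite modn_small // F1 subnn subSnn /=.
      by split=> //; rewrite eq_sym.
    - rewrite modn_small // F2 subSnn S2 /=.
      by split=> //; rewrite eq_sym.
    rewrite modnn S2 (_ : 0 < M) /=; last lia.
    by split=> //; rewrite eq_sym.
  rewrite !big_ord_recr /=.
  have sumE x : \sum_(i < M) ((if i < M then g i else
      nth (c 0) [:: g 0; c M.-1; c 0] (i - M)) == x) = \sum_(i < M) (g i == x).
    by apply: eq_bigr => i _; rewrite ltn_ord.
  rewrite !sumE F1 F2 ltnn subnn subSnn S2 /=.
  have /= := bal a b; have := third a; have := third b; lia.
have [a minN] : exists a, forall b, N a <= N b.
  by case: (@arg_minnP _ ord0 predT N) => // a _ min_a; exists a => b; apply: min_a.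
have [m maxN] : exists m, forall b, N b <= N m.
  by case: (@arg_maxnP _ ord0 predT N) => // m _ max_m; exists m => b; apply: max_m.
have other (x : 'I_3) : exists y, x != y.
  by case: (eqVneq x ord0) => [->|nx]; [exists ord_max | exists ord0].
have [L1|[L2|[L3|L4]]] : L = 1 \/ L = 2 \/ L = 3 \/ L = 4 by lia.
- exists (fun=> a), (fun=> a); rewrite L1; split=> // x y; rewrite !big_ord1.
  have := balN x y; have := minN y; case: (eqVneq a x) => [<-|]; lia.
- have [y ay] := other a; have [z [za zy _]] := ord3_third ay.
  exists (nth y [:: y; z]), (fun=> a); rewrite L2; split=> [_ [|[|//]] _|x x'] /=.
  + by rewrite eq_sym.
  + by split=> //; rewrite eq_sym.
  rewrite !big_ord_recr !big_ord0 /=.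
  have := balN x x'; have := minN x'; case: (eqVneq a x) => [<-|]; lia.
- have [y ay] := other a; have [z [za zy zP]] := ord3_third ay.
  exists (nth y [:: a; y; z]), (nth y [:: y; z; a]); rewrite L3.
  split=> [_ [|[|[|//]]] _|x x'] /=.
  + by split=> //; rewrite eq_sym.
  + by split=> //; rewrite eq_sym.
  + by split=> //; rewrite eq_sym.
  rewrite !big_ord_recr !big_ord0 /=.
  have := zP x; have := zP x'; have := balN x x'; lia.
(* In a 4-cycle the colour [m], missing most often so far, is used on two opposite edges and hence
   is missing nowhere. *)
have [y my] := other m; have [z [zm zy zP]] := ord3_third my.
exists (nth y [:: y; m; z; m]), (nth y [:: z; z; y; y]); rewrite L4.
split=> [_ [|[|[|[|//]]]] _|x x'] /=.
- by split=> //; rewrite eq_sym.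
- by split=> //; rewrite eq_sym.
- by split=> //; rewrite eq_sym.
- by split=> //; rewrite eq_sym.
rewrite !big_ord_recr !big_ord0 /=.
have := zP x; have := zP x'; have := balN x x'; have := maxN x.
by case: (eqVneq m x) => [<-|_]; case: (eqVneq m x') => [<-|_]; lia.
Qed.

(* [col v] is the colour of the edge from [v] to [pi v]; [g v] is a colour missing
   at [v]. *)
Lemma perm_balanced_coloring (V : finType) (pi : {perm V}) :
  exists col g : V -> 'I_3,
    (forall v, pi v != v ->
      [/\ col v != col (pi v), g v != col v & g (pi v) != col v]) /\
    balanced (fun a => #|[set v | g v == a]|).
Proof.
(* Stable sets allow an induction that removes one orbit at a time, each orbit being coloured as a
   cycle. *)
suff colS (S : {set V}) : (forall v, v \in S -> pi v \in S) ->
    exists col g : V -> 'I_3,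
    (forall v, v \in S -> pi v != v ->
      [/\ col v != col (pi v), g v != col v & g (pi v) != col v]) /\
    balanced (fun a => #|[set v in S | g v == a]|).
  have [//|col [g [colP bal]]] := colS setT.
  exists col, g; split=> [v|a b]; first exact: colP.
  have := bal a b; congr (_ <= _ + _); apply: eq_card => v; by rewrite !inE.
have [n] := ubnP #|S|; elim: n => // n IHn in S *; rewrite ltnS => leSn stS.
have [->|[v vS]] := set_0Vmem S.
  exists (fun=> ord0), (fun=> ord0); split=> [v|a b]; first by rewrite inE.
  rewrite (_ : [set _ in _ | _] = set0) ?cards0 //.
  by apply/setP=> v; rewrite !inE.
have [O OE] : exists O, O = porbit pi v by exists (porbit pi v).
have memO u : (u \in O) = (u \in traject pi v #|O|) by rewrite OE -porbit_traject.
have uO : uniq (traject pi v #|O|) by rewrite OE uniq_traject_porbit.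
have loop : iter #|O| pi v = v by rewrite OE iter_porbit.
have vO : v \in O by rewrite OE porbit_id.
have piO u : (pi u \in O) = (u \in O).
  rewrite OE -!eq_porbit_mem (eqP (_ : porbit pi (pi u) == porbit pi u)) //.
  by rewrite eq_porbit_mem (mem_porbit pi 1).
have subO : O \subset S.
  apply/subsetP=> u; rewrite memO => /trajectP[i _ ->].
  by elim: i => //= i; apply: stS.
have [||col [g [colP bal]]] := IHn (S :\: O).
- apply: leq_trans leSn; apply/proper_card/properP; split; first exact: subsetDl.
  by exists v; rewrite // inE vO.
- by move=> u; rewrite !inE piO => /andP[-> /stS].
have O_gt0 : 0 < #|O| by apply/card_gt0P; exists v.
have [c' [g' [pat bal']]] := balanced_cycle_pattern O_gt0 bal.
pose ix u := index u (traject pi v #|O|).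
have lt_ix u : u \in O -> ix u < #|O|.
  by rewrite memO -index_mem size_traject.
have ix_pi u : u \in O -> ix (pi u) = (ix u).+1 %% #|O|.
  move=> uiO; have ltu := lt_ix u uiO.
  have uE : u = iter (ix u) pi v by rewrite -(nth_traject pi ltu) nth_index -?memO.
  have [ltu1|leu1] := ltnP (ix u).+1 #|O|.
    rewrite modn_small // {1}uE -iterS -(nth_traject pi ltu1).
    by rewrite /ix index_uniq ?size_traject.
  have eqO : (ix u).+1 = #|O| by lia.
  rewrite eqO modnn {1}uE -iterS eqO loop /ix.
  by case: #|O| O_gt0 => // m _; rewrite trajectS /= eqxx.
exists (fun u => if u \in O then c' (ix u) else col u).
exists (fun u => if u \in O then g' (ix u) else g u).
split=> [u uS|a b].
  rewrite piO; case: ifPn => uiO npi; last by apply: colP; rewrite ?inE ?uiO.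
  rewrite ix_pi //; apply: pat; last exact: lt_ix.
  rewrite ltn_neqAle O_gt0 andbT; apply: contra npi => /eqP O1.
  have [x Ox] : exists x, O = [set x] by apply/cards1P; rewrite -O1.
  by have := piO u; move: uiO; rewrite Ox !inE => /eqP <-; rewrite eqxx => ->.
suff count x : #|[set u in S | (if u \in O then g' (ix u) else g u) == x]| =
    #|[set u in S :\: O | g u == x]| + \sum_(i < #|O|) (g' i == x).
  by rewrite !count; apply: bal'.
rewrite -(cardsID O) addnC; congr (_ + _).
  by apply: eq_card => u; rewrite !inE; case: (u \in O); rewrite ?andbF ?andbT.
rewrite (_ : _ :&: _ = [set u in O | g' (ix u) == x]); last first.
  apply/setP=> u; rewrite !inE; case uiO: (u \in O); rewrite ?andbF ?andbT //.
  by rewrite (subsetP subO).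
rewrite -sum1dep_card big_mkcondr /= (eq_bigl (mem (traject pi v #|O|)) _ memO).
rewrite -big_uniq // (big_nth v) size_traject big_mkord.
by apply: eq_bigr => i _; rewrite /ix index_uniq ?size_traject //; case: (_ == _).
Qed.

(** * Routing demands *)

Lemma eq_set2 (T : finType) (a b c d : T) :
  [set a; b] = [set c; d] -> (a = c /\ b = d) \/ (a = d /\ b = c).
Proof.
move=> eqS; have := set21 a b; have := set22 a b; have := set21 c d; have := set22 c d.
rewrite eqS -{1 2}eqS.
by do 4![case/set2P=> ?]; subst; try by [left|right].
Qed.

Definition owned_edge (V E : finType) (G : rel V) (o : {set V} -> option E) (e : E) : rel V :=
  fun x y => G x y && (o [set x; y] == Some e).

(* [p (e, true)] and [p (e, false)] are the ends of the demand [e]. Disjointness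
   of the routes is encoded by letting each edge of [G] have at most one owner. *)
Definition routable (V E : finType) (G : rel V) (p : E * bool -> V) :=
  exists o : {set V} -> option E,
    forall e, connect (owned_edge G o e) (p (e, true)) (p (e, false)).

Lemma connect_homo (V W : finType) (r : rel V) (s : rel W) (f : V -> W) x y :
    (forall u v, r u v -> connect s (f u) (f v)) ->
  connect r x y -> connect s (f x) (f y).
Proof.
move=> rs /connectP[w]; elim: w x => [|z w IHw] x /= => [_ -> //|/andP[rxz rw] eqy].
exact: connect_trans (rs _ _ rxz) (IHw _ rw eqy).
Qed.

Lemma routable_homo (V W E : finType) (f : V -> W) (G : rel V) (H : rel W)
    (p : E * bool -> V) :
    injective f -> (forall x y, G x y -> H (f x) (f y)) ->
  routable G p -> routable H (f \o p).
Proof.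
move=> fI GH [o oP]; exists (fun S : {set W} => o (f @^-1: S)) => e /=.
apply: connect_homo (oP e) => u v /andP[/GH Huv ouv]; apply: connect1.
rewrite /owned_edge Huv (_ : _ @^-1: _ = [set u; v]) //.
by apply/setP=> x; rewrite !inE !(inj_eq fI).
Qed.

Lemma routable_restrict (V E : finType) (A : pred E) (G : rel V) (p : E * bool -> V) :
    (forall e, ~~ A e -> p (e, true) = p (e, false)) ->
    routable G (fun h : {e | A e} * bool => p (val h.1, h.2)) ->
  routable G p.
Proof.
move=> loopA [o oP]; exists (fun S : {set V} => omap val (o S)) => e.
have [Ae|/loopA->] := boolP (A e); last exact: connect0.
apply: connect_sub (oP (Sub e Ae)) => u v /andP[Guv ouv]; apply: connect1.
by rewrite /owned_edge Guv (eqP ouv) /=.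
Qed.

(** One round of routing: half-edges move along distinct single edges outside [H], and the demands
    continue within [H]. Edges of [H] keep their owner; any other edge belongs to the demand that
    moved along it. *)
Lemma routable_move (V E : finType) (G H : rel V) (p q : E * bool -> V) :
    symmetric G -> symmetric H -> subrel H G ->
    (forall h, p h != q h -> G (p h) (q h) && ~~ H (p h) (q h)) ->
    (forall h h', p h != q h -> p h' != q h' ->
       [set p h; q h] = [set p h'; q h'] -> h = h') ->
  routable H q -> routable G p.
Proof.
move=> symG symH HG moveG moveI [o oP].
pose inH (S : {set V}) := [exists x, exists y, (S == [set x; y]) && H x y].
have inHE x y : inH [set x; y] = H x y.
  apply/existsP/idP => [[u /existsP[v /andP[/eqP/eq_set2[[-> ->]//|[-> ->]]]]]|Hxy].
    by rewrite symH.
  by exists x; apply/existsP; exists y; rewrite eqxx.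
pose o' (S : {set V}) := if inH S then o S
             else omap fst [pick h | (p h != q h) && (S == [set p h; q h])].
have step h : connect (owned_edge G o' h.1) (p h) (q h).
  have [->|pq] := eqVneq (p h) (q h); first exact: connect0.
  have /andP[Gpq nHpq] := moveG h pq.
  apply: connect1; rewrite /owned_edge Gpq /o' inHE (negPf nHpq).
  case: pickP => [h' /andP[pq' /eqP eqS]|/(_ h)]; last by rewrite pq eqxx.
  by rewrite (moveI _ _ pq pq' eqS) /=.
have sym_owned e : symmetric (owned_edge G o' e).
  by move=> x y; rewrite /owned_edge symG setUC.
exists o' => e; apply: connect_trans (step (e, true)) _.
apply: (@connect_trans _ _ (q (e, false))).
  apply: connect_sub (oP e) => u v /andP[Huv ouv]; apply: connect1.
  by rewrite /owned_edge HG // /o' inHE Huv.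
by rewrite (sym_connect_sym (sym_owned e)); apply: step (e, false).
Qed.

(** * Complete graphs *)

(** Each of the two other classes exceeds this one by at most 2. *)
Lemma balanced_card (V : finType) (g : V -> 'I_3) (a : 'I_3) :
  balanced (fun a => #|[set v | g v == a]|) -> #|V| <= 3 * #|[set v | g v == a]| + 4.
Proof.
move=> bal; have := card_fiber_sumT g setT.
rewrite [LHS](_ : _ = #|V|); last by rewrite -cardsT; apply: eq_card => v; rewrite !inE.
move=> ->; rewrite (bigD1 a (in_setT a)) /=; set N := #|[set v | g v == a]|.
apply: (@leq_trans (N + \sum_(b in [set: 'I_3] | b != a) (N + 2))).
  by rewrite leq_add2l; apply: leq_sum => b _; apply: bal.
rewrite sum_nat_const (_ : #|_| = 2); first by lia.
have := cardC1 a; rewrite card_ord /= => eq2; rewrite -[RHS]eq2.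
by apply: eq_card => b; rewrite !inE [LHS]unfold_in /= in_setT.
Qed.

Lemma card_imset_sep (A V : finType) (w : A -> V) (P : pred V) :
  #|[set v in w @: setT | P v]| <= #|[set a | P (w a)]|.
Proof.
apply: leq_trans (leq_imset_card w _); apply/subset_leq_card/subsetP=> v.
by rewrite inE => /andP[/imsetP[a _ ->] Pwa]; apply: imset_f; rewrite inE.
Qed.

Lemma card_injective_pred (A B : finType) (f : A -> B) b :
  injective f -> #|[set a | f a == b]| <= 1.
Proof.
move=> fI; apply/card_le1_eqP => x y; rewrite !inE => /eqP fx /eqP fy.
by apply: fI; rewrite fx.
Qed.

(** * Half-edges of a factor and their moves to hubs *)

Section Factor.
Variables (V E : finType) (p : E * bool -> V) (c : E -> nat) (o : E -> bool).
Hypothesis srcI : forall e f, c e = c f -> p (e, o e) = p (f, o f) -> e = f.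
Hypothesis tgtI : forall e f, c e = c f -> p (e, ~~ o e) = p (f, ~~ o f) -> e = f.

Lemma half_edge_inj h h' : p h = p h' -> c h.1 = c h'.1 ->
  (h.2 == o h.1) = (h'.2 == o h'.1) -> h = h'.
Proof.
case: h h' => [e b] [f b'] /=.
case: (eqVneq b (o e)) => [->|/eqP]; case: (eqVneq b' (o f)) => [->|/eqP] //.
  by move=> pef cef _; rewrite (srcI cef pef).
move=> fb' eb pef cef _; have eb' : b = ~~ o e by case: b (o e) eb {pef} => [] [].
have fb : b' = ~~ o f by case: b' (o f) fb' {pef} => [] [].
by move: pef; rewrite eb' fb => /(tgtI cef) ->.
Qed.

(** Each of the [k - i] remaining factors has at most one outgoing and one incoming half-edge at
    [v]. *)
Lemma card_half_edges_ge i k v : (forall e, c e < k) ->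
  #|[set h in half_edges p v | i <= c h.1]| <= (k - i).*2.
Proof.
move=> ck; pose f (h : E * bool) := (Ordinal (ck h.1), h.2 == o h.1).
rewrite -(@card_in_imset _ _ f) => [|h h']; last first.
  rewrite !inE => /andP[/eqP ph _] /andP[/eqP ph' _] [ch oh].
  by apply: half_edge_inj; rewrite ?ph.
have <- : #|setX [set j : 'I_k | i <= j] [set: bool]| = (k - i).*2.
  rewrite cardsX cardsT card_bool muln2 -sum1dep_card big_mkcond; congr _.*2.
  elim: (k) => [|m IHm]; first by rewrite big_ord0.
  by rewrite big_ord_recr /= IHm; case: leqP; lia.
by apply/subset_leq_card/subsetP=> _ /imsetP[h hP ->]; move: hP; rewrite !inE andbT => /andP[].
Qed.

Variables (i : nat) (pi : {perm V}) (col g : V -> 'I_3).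
Hypothesis noloop : forall e, p (e, true) != p (e, false).
Hypothesis pi_arc : forall e, c e = i -> pi (p (e, o e)) = p (e, ~~ o e).
Hypothesis colP : forall v, pi v != v ->
  [/\ col v != col (pi v), g v != col v & g (pi v) != col v].

Lemma pi_arc_neq e : c e = i -> pi (p (e, o e)) != p (e, o e).
Proof.
by move=> /pi_arc->; have := noloop e; case: (o e) => //=; rewrite eq_sym.
Qed.

(** An edge carries the colour of its tail, and [g] gives a colour missing at both of its ends. *)
Lemma half_edge_col_neq h : c h.1 = i -> col (p (h.1, o h.1)) != g (p h).
Proof.
case: h => e b /= ce; have [_ gs gt] := colP (pi_arc_neq ce).
have [->|bo] := eqVneq b (o e); first by rewrite eq_sym.
have -> : b = ~~ o e by case: b (o e) bo => [] [].
by rewrite -pi_arc // eq_sym.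
Qed.

(** Two half-edges in the same direction at a vertex coincide already; an incoming and an outgoing
    one belong to consecutive arcs of [pi], whose colours differ. *)
Lemma half_edge_col_inj h h' : c h.1 = i -> c h'.1 = i -> p h = p h' ->
  col (p (h.1, o h.1)) = col (p (h'.1, o h'.1)) -> h = h'.
Proof.
have mixed e f b : b != o f -> c e = i -> c f = i -> p (e, o e) = p (f, b) ->
    col (p (e, o e)) != col (p (f, o f)).
  move=> bo ce cf pef; have -> : p (e, o e) = pi (p (f, o f)).
    by rewrite pi_arc // pef; case: b (o f) bo {pef} => [] [].
  by have [+ _ _] := colP (pi_arc_neq cf); rewrite eq_sym.
case: h h' => [e b] [f b'] /= ce cf pef colef.
apply: half_edge_inj; rewrite //= ?ce //; move: pef.
case: (eqVneq b (o e)) => [->|bo]; case: (eqVneq b' (o f)) => [->|fo] //.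
  by move=> pef; have := mixed _ _ _ fo ce cf pef; rewrite colef eqxx.
by move=> /esym pfe; have := mixed _ _ _ bo cf ce pfe; rewrite colef eqxx.
Qed.

Variables (rho : 'I_3 -> 'I_3) (w : 'I_3 -> V).
Hypothesis rhoI : injective rho.
Hypothesis rhoP : forall a b, a != b -> (rho a == b) || (rho b == a).
Hypothesis gw : forall a, g (w a) = rho a.

Lemma hub_inj : injective w.
Proof. by move=> a b /(congr1 g); rewrite !gw => /rhoI. Qed.

(* The edge between the hubs [w a] and [w b] would be used twice if [w a] saw the
   colour b and [w b] the colour a; [gw] and [rhoP] exclude this. *)
Lemma hub_edge_inj h h' : c h.1 = i -> c h'.1 = i ->
  let u := w (col (p (h.1, o h.1))) in let u' := w (col (p (h'.1, o h'.1))) in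
  p h != u -> p h' != u' -> [set p h; u] = [set p h'; u'] -> h = h'.
Proof.
move=> ch ch' /= hu hu' /eq_set2[[ph /hub_inj]|[ph ph']]; first exact: half_edge_col_inj.
have := half_edge_col_neq ch; have := half_edge_col_neq ch'.
rewrite -ph' ph !gw => nab nba; case: (eqVneq (col (p (h.1, o h.1))) (col (p (h'.1, o h'.1)))).
  by move=> ecol; rewrite ph ecol eqxx in hu.
by move/rhoP; rewrite !(eq_sym (rho _)) (negPf nab) (negPf nba).
Qed.
End Factor.

(** Of two distinct elements of ['I_3] one cyclically follows the other. *)
Lemma cyclic_pred3 : exists rho : 'I_3 -> 'I_3,
  injective rho /\ forall a b, a != b -> (rho a == b) || (rho b == a).
Proof.
exists (@ordS 3); split; first exact: ordS_inj.
by move=> [[|[|[|//]]] ?] [[|[|[|//]]] ?].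
Qed.

Lemma routable_no_half_edges (V E : finType) (G : rel V) (p : E * bool -> V) :
  (forall v, #|half_edges p v| <= 0) -> routable G p.
Proof.
move=> deg0; exists (fun=> None) => e; exfalso.
have := deg0 (p (e, true)); rewrite leqn0 cards_eq0 => /eqP/setP/(_ (e, true)).
by rewrite !inE eqxx.
Qed.

(** With one factor, one triple of hubs suffices: both ends of a demand move to the hub of its
    colour and meet there, so nothing is left to route in the empty graph. *)
Lemma routable_single_factor (V E : finType) (p : E * bool -> V) :
    12 <= #|V| -> (forall e, p (e, true) != p (e, false)) ->
    (forall v, #|half_edges p v| <= 2) ->
  routable (fun x y => x != y) p.
Proof.
move=> leV noloop deg.
have [c [o [ck srcI tgtI]]] := @two_factorization _ _ p 1 deg.
have c0 e : c e = 0 by have := ck e; case: (c e).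
have [pi piP] := @perm_of_arcs V E setT (fun e => p (e, o e)) (fun e => p (e, ~~ o e))
  (fun e f _ _ => srcI e f (etrans (c0 e) (esym (c0 f))))
  (fun e f _ _ => tgtI e f (etrans (c0 e) (esym (c0 f)))).
have [col [g [colP bal]]] := perm_balanced_coloring pi.
have [rho [rhoI rhoP]] := cyclic_pred3.
have /fin_all_exists[w gw] a : exists v, g v = rho a.
  have := balanced_card (rho a) bal; case: (set_0Vmem [set v | g v == rho a]).
    by move=> ->; rewrite cards0; lia.
  by case=> v; rewrite inE => /eqP; exists v.
have arc e : c e = 0 -> pi (p (e, o e)) = p (e, ~~ o e) by move=> _; apply: piP.
pose q (h : E * bool) := w (col (p (h.1, o h.1))).
apply: (@routable_move _ _ _ (fun _ _ => false) p q) => //.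
- by move=> x y; rewrite eq_sym.
- by move=> h ->.
- by move=> h h'; apply: (hub_edge_inj srcI tgtI noloop arc colP rhoI rhoP gw (c0 _) (c0 _)).
by exists (fun=> None) => e; rewrite /q /= connect0.
Qed.

Lemma routable_two_factors k (V E : finType) (p : E * bool -> V) :
    (forall (V' E' : finType) (p' : E' * bool -> V'), 6 * k + 6 <= #|V'| ->
       (forall v, #|half_edges p' v| <= k.*2) -> routable (fun x y => x != y) p') ->
    0 < k -> 6 * k.+1 + 6 <= #|V| -> (forall e, p (e, true) != p (e, false)) ->
    (forall v, #|half_edges p v| <= k.+1.*2) ->
  routable (fun x y => x != y) p.
Proof.
move=> IHk k_gt0 leV noloop deg.
have [c [o [ck srcI tgtI]]] := two_factorization deg.
have factor i : exists pi : {perm V}, forall e, c e = i -> pi (p (e, o e)) = p (e, ~~ o e).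
  have [||pi piP] := @perm_of_arcs V E [set e | c e == i] (fun e => p (e, o e))
                       (fun e => p (e, ~~ o e)).
  - by move=> e f; rewrite !inE => /eqP ce /eqP cf; apply: srcI; rewrite ce.
  - by move=> e f; rewrite !inE => /eqP ce /eqP cf; apply: tgtI; rewrite ce.
  by exists pi => e ce; apply: piP; rewrite inE ce.
have [pi1 pi1P] := factor 0; have [pi2 pi2P] := factor 1.
have [col1 [g1 [col1P bal1]]] := perm_balanced_coloring pi1.
have [col2 [g2 [col2P bal2]]] := perm_balanced_coloring pi2.
(* A class of size [N] satisfies [6 * k + 12 <= 3 * N + 4]; rounding up gives the bound. *)
have miss1 a : k.*2 + 3 <= #|[set v | g1 v == a]|.
  by have := balanced_card a bal1; lia.
have miss2 a : k.*2 + 3 <= #|[set v | g2 v == a]|.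
  by have := balanced_card a bal2; lia.
have [rho [rhoI rhoP]] := cyclic_pred3.
have /fin_all_exists[w1 g1w] a : exists v, g1 v = rho a.
  have : 0 < #|[set v | g1 v == rho a]| by apply: leq_trans (miss1 _); lia.
  by case/card_gt0P=> v; rewrite inE => /eqP; exists v.
pose W1 := w1 @: setT.
have cardW1 : #|W1| <= 3 by rewrite (leq_trans (leq_imset_card _ _)) // cardsT card_ord.
have outside (g : V -> 'I_3) a : k.*2 + 3 <= #|[set v | g v == a]| ->
    exists2 v, v \notin W1 & g v = a.
  move=> lega; have : 0 < #|[set v | g v == a] :\: W1|.
    have := subset_leq_card (subsetIr [set v | g v == a] W1).
    by rewrite cardsD; lia.
  by case/card_gt0P=> v; rewrite !inE => /andP[vW /eqP ga]; exists v.
(* [g1] must not be constant on W2, otherwise too few of the edges left over for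
   some hub of W1 lead outside the hubs. *)
have [z1 [z2 [z1W z2W z12g1 z12g2]]] : exists z1, exists z2,
    [/\ z1 \notin W1, z2 \notin W1, g1 z1 != g1 z2 & g2 z1 != g2 z2].
  have [x xW g1x] := outside g1 ord0 (miss1 _).
  have [y yW g1y] := outside g1 ord_max (miss1 _).
  have g1xy : g1 x != g1 y by rewrite g1x g1y.
  (* If [x] and [y] agree in [g2], a vertex [z] with another value of [g2] differs in [g1] from one
     of them. *)
  have [g2xy|] := eqVneq (g2 x) (g2 y); last by exists x, y.
  have [z zW g2z] : exists2 z, z \notin W1 & g2 z != g2 x.
    have [b bx] : exists b, b != g2 x.
      by case: (eqVneq (g2 x) ord0) => [->|]; [exists ord_max | exists ord0; rewrite eq_sym].
    by have [z zW gz] := outside g2 b (miss2 _); exists z; rewrite ?gz.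
  have [g1xz|] := eqVneq (g1 x) (g1 z); last by exists x, z; rewrite (eq_sym (g2 x)).
  by exists y, z; split; rewrite -?g1xz -?g2xy // eq_sym.
(* The two implications make [z1] and [z2] hubs of the second triple. *)
have /fin_all_exists[w2 w2P] a : exists v, [/\ v \notin W1, g2 v = rho a,
    rho a = g2 z1 -> v = z1 & rho a = g2 z2 -> v = z2].
  have [az1|az1] := eqVneq (rho a) (g2 z1).
    by exists z1; split=> // az2; rewrite -az1 az2 eqxx in z12g2.
  have [az2|az2] := eqVneq (rho a) (g2 z2).
    by exists z2; split=> // az; rewrite az eqxx in az1.
  have [v vW gv] := outside g2 (rho a) (miss2 _); exists v; split=> // eqa.
    by rewrite eqa eqxx in az1.
  by rewrite eqa eqxx in az2.
have g2w a : g2 (w2 a) = rho a by have [] := w2P a.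
have w2W1 a : w2 a \notin W1 by have [] := w2P a.
have w1W1 a : w1 a \in W1 by apply: imset_f.
have w12 a b : w1 a != w2 b by apply: contraNneq (w2W1 b) => <-.
have w1I := hub_inj rhoI g1w; have w2I := hub_inj rhoI g2w.
have g1w2 a : #|[set b | g1 (w2 b) == a]| <= 2.
  have [rho' _ rhoK] := injF_bij rhoI.
  have w2z1 : w2 (rho' (g2 z1)) = z1 by have [_ _ -> //] := w2P (rho' (g2 z1)); rewrite rhoK.
  have w2z2 : w2 (rho' (g2 z2)) = z2 by have [_ _ _ -> //] := w2P (rho' (g2 z2)); rewrite rhoK.
  have [b nb] : exists b, g1 (w2 b) != a.
    have [<-|] := eqVneq (g1 z1) a; last by exists (rho' (g2 z1)); rewrite w2z1.
    by exists (rho' (g2 z2)); rewrite w2z2 eq_sym.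
  have : [set b | g1 (w2 b) == a] \subset ~: [set b].
    by apply/subsetP=> b'; rewrite !inE; apply: contraTneq => ->.
  by move/subset_leq_card; rewrite cardsC1 card_ord.
pose W2 := w2 @: setT; pose W := W1 :|: W2.
have w1W a : w1 a \in W by rewrite inE w1W1.
have w2W a : w2 a \in W by rewrite inE orbC imset_f.
have cardW : #|W| <= 6.
  have := leq_imset_card w2 setT; rewrite cardsT card_ord -/W2.
  by have := (leq_card_setU W1 W2).1; rewrite -/W; lia.
pose hue1 (h : E * bool) := col1 (p (h.1, o h.1)).
pose hue2 (h : E * bool) := col2 (p (h.1, o h.1)).
(* Half-edges of the second factor at [W1] stay, since a move from [W1] to [W2] could reuse an edge
   along which the first factor moves from [W2] to [W1]. *)
pose pos1 (h : E * bool) := if c h.1 == 0 then w1 (hue1 h)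
               else if (c h.1 == 1) && (p h \notin W1) then w2 (hue2 h) else p h.
(* The demands still unrouted after the move to [pos1], which the second move
   takes to [pos2]. *)
pose A e := (c e != 0) && ~~ [&& c e == 1, p (e, true) \notin W1 & p (e, false) \notin W1].
pose Q (w : V) := [set h | A h.1 & pos1 h == w].
(* These vertices do not see the colour of the hub [w], so their edge to [w] is still free after the
   first move. *)
pose S (w : V) := [set v | (v \notin W) && ((w == w1 (g1 v)) || (w == w2 (g2 v)))].
have hue1_neq h : c h.1 = 0 -> hue1 h != g1 (p h).
  exact: (half_edge_col_neq noloop pi1P col1P).
have hue2_neq h : c h.1 = 1 -> hue2 h != g2 (p h).
  exact: (half_edge_col_neq noloop pi2P col2P).
have hue2_inj h h' : c h.1 = 1 -> c h'.1 = 1 -> p h = p h' -> hue2 h = hue2 h' -> h = h'.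
  exact: (half_edge_col_inj srcI tgtI noloop pi2P col2P).
have moved1 h : p h != pos1 h -> (c h.1 = 0 /\ pos1 h = w1 (hue1 h)) \/
    [/\ c h.1 = 1, p h \notin W1 & pos1 h = w2 (hue2 h)].
  rewrite /pos1; case: (eqVneq (c h.1) 0) => [->|_]; first by left.
  by case: ifP => [/andP[/eqP -> ->] _|_ /eqP //]; right.
have capacity w : w \in W -> #|Q w| <= #|S w|.
  case/setUP=> /imsetP[a _ ->{w}].
    (* The first factor is finished and nothing else has moved to [w1 a]. Among the [k.*2 + 3]
       vertices missing [a], at most 1 lies in [W1] and at most 2 in [W2], which leaves [k.*2]. *)
    have leQ : #|Q (w1 a)| <= k.*2.
      have := card_half_edges_ge srcI tgtI 1 (w1 a) ck; rewrite subn1 /=.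
      apply/leq_trans/subset_leq_card/subsetP=> h; rewrite !inE /A /pos1.
      rewrite lt0n => /andP[/andP[c0 _]]; rewrite c0 (negPf c0) /= andbT.
      by case: ifP => // _; rewrite eq_sym (negPf (w12 _ _)).
    have sub : [set v | g1 v == a] \subset S (w1 a) :|:
        ([set v in W1 | g1 v == a] :|: [set v in W2 | g1 v == a]).
      apply/subsetP=> v; rewrite !inE => /eqP ->; rewrite !eqxx orTb !andbT.
      by case: (v \in W1); case: (v \in W2).
    have c1 : #|[set v in W1 | g1 v == a]| <= 1.
      apply: leq_trans (card_imset_sep w1 (fun v => g1 v == a)) _.
      by under eq_finset do rewrite g1w; apply: card_injective_pred.
    have c2 : #|[set v in W2 | g1 v == a]| <= 2.
      exact: leq_trans (card_imset_sep w2 (fun v => g1 v == a)) (g1w2 a).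
    have := subset_leq_card sub; have := miss1 a.
    have := (leq_card_setU (S (w1 a)) ([set v in W1 | g1 v == a] :|: [set v in W2 | g1 v == a])).1.
    have := (leq_card_setU [set v in W1 | g1 v == a] [set v in W2 | g1 v == a]).1.
    lia.
  (* R: half-edges of the second factor moved to this hub although the other end
     of their edge is in W1. *)
  pose other (h : E * bool) := p (h.1, ~~ h.2).
  pose R := [set h | [&& c h.1 == 1, p h \notin W1, other h \in W1 & hue2 h == a]].
  have leQ : #|Q (w2 a)| <= k.-1.*2 + #|R|.
    have := card_half_edges_ge srcI tgtI 2 (w2 a) ck; rewrite subSS subn1 -(leq_add2r #|R|).
    apply: leq_trans; apply: leq_trans (leq_card_setU _ _).1.
    apply/subset_leq_card/subsetP=> -[e b]; rewrite !inE /A /pos1 /other /=.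
    move=> /andP[/andP[c0 nin]]; rewrite (negPf c0) /=.
    case: (ltngtP (c e) 1) => [c_lt1|c_gt1|c1] /=; first by case: (c e) c0 c_lt1.
      by move=> ->.
    case: (boolP (p (e, b) \in W1)) => pW1 /=.
      by move=> /eqP pw2; move: pW1; rewrite pw2 (negPf (w2W1 _)).
    have oW : p (e, ~~ b) \in W1.
      by apply: contraR nin => no; rewrite c1 eqxx; case: b pW1 no => /= -> ->.
    by rewrite (inj_eq w2I) => ->; rewrite oW orbT.
  have leR : #|R| <= #|[set u in W1 | g2 u != a]|.
    rewrite -(@card_in_imset _ _ other) => [|h h']; last first.
      rewrite !inE => /and4P[/eqP ch _ _ /eqP hue] /and4P[/eqP ch' _ _ /eqP hue'] oth.
      have := @hue2_inj (h.1, ~~ h.2) (h'.1, ~~ h'.2) ch ch' oth.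
      rewrite /hue2 /= -/(hue2 h) -/(hue2 h') hue hue' => /(_ erefl).
      by case: h h' {ch ch' hue hue' oth} => [e b] [f b'] [-> /negb_inj ->].
    apply/subset_leq_card/subsetP=> _ /imsetP[h hR ->].
    move: hR; rewrite !inE => /and4P[/eqP ch _ -> /eqP hue] /=.
    by rewrite eq_sym -hue; apply: (hue2_neq (h.1, ~~ h.2)).
  (* A vertex of [W1] either misses [a] and is lost to [S (w2 a)], or may add an element to [R].
     With [r] vertices of the second kind, [Q (w2 a)] has at most [k.-1.*2 + r] elements and
     [S (w2 a)] at least [k.*2 + 3 - (3 - r) - 1]. *)
  have cW1 : #|[set u in W1 | g2 u == a]| + #|[set u in W1 | g2 u != a]| <= 3.
    apply: leq_trans cardW1; rewrite -(cardsID [set u | g2 u == a] W1).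
    apply: eq_leq; congr (_ + _); apply: eq_card => u; rewrite !inE //.
    by rewrite andbC.
  have sub : [set v | g2 v == a] \subset S (w2 a) :|:
      ([set v in W1 | g2 v == a] :|: [set v in W2 | g2 v == a]).
    apply/subsetP=> v; rewrite !inE => /eqP ->; rewrite !eqxx orbT !andbT.
    by case: (v \in W1); case: (v \in W2).
  have c2 : #|[set v in W2 | g2 v == a]| <= 1.
    apply: leq_trans (card_imset_sep w2 (fun v => g2 v == a)) _.
    by under eq_finset do rewrite g2w; apply: card_injective_pred.
  have := subset_leq_card sub; have := miss2 a.
  have := (leq_card_setU (S (w2 a)) ([set v in W1 | g2 v == a] :|: [set v in W2 | g2 v == a])).1.
  have := (leq_card_setU [set v in W1 | g2 v == a] [set v in W2 | g2 v == a]).1.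
  lia.
have /fin_all_exists[lam lamP] w : exists f : E * bool -> V, w \in W ->
    {in Q w &, injective f} /\ {in Q w, forall h, f h \in S w}.
  have [wW|_] := boolP (w \in W); last by exists (fun=> w).
  by have [f fP] := inj_on_exists w (capacity w wW); exists f.
pose pos2 (h : E * bool) := if A h.1 && (pos1 h \in W) then lam (pos1 h) h else pos1 h.
have lift h : A h.1 -> pos1 h \in W -> lam (pos1 h) h \in S (pos1 h).
  by move=> Ah /lamP[_ lamS]; apply: lamS; rewrite inE Ah eqxx.
have pos2W h : A h.1 -> pos2 h \notin W.
  move=> Ah; rewrite /pos2 Ah /=; case: ifPn => // pW.
  by have := lift h Ah pW; rewrite inE => /andP[].
have moved2 h : pos1 h != pos2 h ->
    [/\ A h.1, pos1 h \in W, pos2 h = lam (pos1 h) h & pos2 h \in S (pos1 h)].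
  rewrite /pos2; case: ifP => [/andP[Ah pW] _|_ /eqP //]; split=> //; exact: lift.
have pos1W h : p h != pos1 h -> pos1 h \in W by case/moved1=> [[_ ->]|[_ _ ->]].
(* [G1] is what the first move leaves over. The second move uses edges of [G1] between hubs and
   other vertices, and [G2] is the complete graph outside the hubs. *)
pose used (T : {set V}) := [exists h, (p h != pos1 h) && (T == [set p h; pos1 h])].
pose G1 : rel V := fun x y => (x != y) && ~~ used [set x; y].
pose G2 : rel V := fun x y => [&& x != y, x \notin W & y \notin W].
apply: (@routable_move _ _ _ G1 p pos1).
- by move=> x y; rewrite eq_sym.
- by move=> x y; rewrite /G1 eq_sym setUC.
- by move=> x y /andP[].
- move=> h mh; rewrite mh /G1 mh negbK; apply/existsP; exists h.
  by rewrite mh eqxx.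
- have mixed h h' : c h.1 = 0 -> pos1 h = w1 (hue1 h) -> p h' \notin W1 ->
      pos1 h' = w2 (hue2 h') -> [set p h; pos1 h] <> [set p h'; pos1 h'].
    move=> ch -> ph' -> /eq_set2[[_ /eqP]|[_ eq1]]; first by rewrite (negPf (w12 _ _)).
    by rewrite -eq1 w1W1 in ph'.
  move=> h h' mh mh' eqS; move: (mh) (mh') eqS.
  case: (moved1 h mh) => [[ch ph]|[ch pW1 ph]]; case: (moved1 h' mh') => [[ch' ph']|[ch' pW1' ph']].
  + rewrite ph ph' => nh nh'.
    exact: (hub_edge_inj srcI tgtI noloop pi1P col1P rhoI rhoP g1w ch ch' nh nh').
  + by move=> _ _ /(mixed _ _ ch ph pW1' ph').
  + by move=> _ _ /esym /(mixed _ _ ch' ph' pW1 ph).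
  rewrite ph ph' => nh nh'.
  exact: (hub_edge_inj srcI tgtI noloop pi2P col2P rhoI rhoP g2w ch ch' nh nh').
apply: (@routable_move _ _ G1 G2 pos1 pos2).
- by move=> x y; rewrite /G1 eq_sym setUC.
- by move=> x y; rewrite /G2 eq_sym; congr (_ && _); rewrite andbC.
- move=> x y /and3P[xy xW yW]; rewrite /G1 xy; apply/existsP=> -[h /andP[/pos1W hW /eqP]].
  by move=> /eq_set2[[_ eqp]|[eqp _]]; [move: yW | move: xW]; rewrite eqp hW.
(* If the first move had used this edge, it would have led from [pos2 h] to a hub whose colour is
   missing at [pos2 h]. *)
- move=> h mh; have [Ah hW _ hS] := moved2 h mh.
  rewrite /G1 /G2 mh hW /= andbT; apply/existsP=> -[h' /andP[mh' /eqP]].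
  move: hS; rewrite inE => /andP[h2W hS].
  move=> /eq_set2[[_ eqp]|[eq1 eq2]]; first by rewrite eqp pos1W in h2W.
  move: hS; rewrite eq1 eq2.
  case: (moved1 h' mh') => [[ch' ->]|[ch' _ ->]].
    by rewrite (inj_eq w1I) (negPf (hue1_neq _ ch')) (negPf (w12 _ _)).
  by rewrite (inj_eq w2I) (negPf (hue2_neq _ ch')) orbF eq_sym (negPf (w12 _ _)).
- move=> h h' mh mh'; have [Ah hW e2 hS] := moved2 h mh; have [Ah' hW' e2' hS'] := moved2 h' mh'.
  move=> /eq_set2[[eq1 eq2]|[eq1 _]]; last first.
    by move: hS'; rewrite inE -eq1 hW.
  have [lamI _] := lamP _ hW; apply: lamI; rewrite ?inE ?Ah ?Ah' -?eq1 ?eqxx //.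
  by rewrite -e2 eq2 e2' eq1.
(* The ends of a demand outside [A] have already met at the hub of its colour. *)
apply: (@routable_restrict _ _ A).
  move=> e nA; have -> : pos2 (e, true) = pos1 (e, true) by rewrite /pos2 (negPf nA).
  have -> : pos2 (e, false) = pos1 (e, false) by rewrite /pos2 (negPf nA).
  move: nA; rewrite negb_and !negbK /pos1 /=.
  case/orP=> [/eqP -> //|/and3P[/eqP c1 -> ->]]; first by rewrite c1.
pose V2 := {v | v \notin W}.
pose p2 (h : {e | A e} * bool) : V2 := Sub (pos2 (val h.1, h.2)) (pos2W (val h.1, h.2) (valP h.1)).
have p2E h : val (p2 h) = pos2 (val h.1, h.2) by [].
have : routable (fun x y => x != y) p2.
  apply: IHk.
    rewrite card_sig (_ : #|_| = #|~: W|); first by have := cardsC W; lia.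
    by apply: eq_card => v; rewrite !inE.
  move=> v.
  pose D := [set h | A h.1 & pos2 h == val v].
  have : #|half_edges p2 v| <= #|D|.
    rewrite -(@card_imset _ _ (fun h : {e | A e} * bool => (val h.1, h.2))).
      apply/subset_leq_card/subsetP=> _ /imsetP[h hv ->].
      by move: hv; rewrite !inE /= -val_eqE p2E (valP h.1).
    by move=> [e b] [f b'] /= [/val_inj -> ->].
  (* A vertex keeps at most [k.-1.*2] half-edges, of index at least 2, and receives at most one from
     each of the two hubs whose colour it misses: [k.*2] in all. *)
  have subD : D \subset [set h in half_edges p (val v) | 2 <= c h.1] :|:
     ([set h in Q (w1 (g1 (val v))) | lam (w1 (g1 (val v))) h == val v] :|:
      [set h in Q (w2 (g2 (val v))) | lam (w2 (g2 (val v))) h == val v]).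
    apply/subsetP=> h; rewrite !inE => /andP[Ah]; rewrite Ah /= /pos2 Ah /=.
    case: (boolP (pos1 h \in W)) => [hW|hW /eqP hv].
      move=> /eqP lamv; have := lift h Ah hW; rewrite inE lamv => /andP[_].
      by case/orP=> /eqP hw; rewrite -hw eqxx lamv eqxx ?orbT.
    have ph : p h = pos1 h by apply/eqP; apply: contraR hW => /pos1W.
    have c0 : c h.1 != 0 by case/andP: Ah.
    rewrite ph hv eqxx /=; case: (ltngtP (c h.1) 1) => // [c_lt1|c1].
      by case: (c _) c0 c_lt1.
    move: hW; rewrite /pos1 (negPf c0) c1 eqxx /=.
    case: ifP => [_|/negbFE pW1]; first by rewrite w2W.
    by rewrite inE pW1.
  have leC w : w \in W -> #|[set h in Q w | lam w h == val v]| <= 1.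
    move=> wW; have [lamI _] := lamP w wW.
    apply/card_le1_eqP=> h h'; rewrite !inE => /andP[hQ /eqP hv] /andP[hQ' /eqP hv'].
    by apply: lamI; rewrite ?inE // hv hv'.
  have := card_half_edges_ge srcI tgtI 2 (val v) ck.
  have := leC _ (w1W (g1 (val v))); have := leC _ (w2W (g2 (val v))).
  have := subset_leq_card subD.
  have := (leq_card_setU [set h in half_edges p (val v) | 2 <= c h.1]
     ([set h in Q (w1 (g1 (val v))) | lam (w1 (g1 (val v))) h == val v] :|:
      [set h in Q (w2 (g2 (val v))) | lam (w2 (g2 (val v))) h == val v])).1.
  have := (leq_card_setU
     [set h in Q (w1 (g1 (val v))) | lam (w1 (g1 (val v))) h == val v]
     [set h in Q (w2 (g2 (val v))) | lam (w2 (g2 (val v))) h == val v]).1.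
  lia.
apply: (@routable_homo V2 V _ val) => [|x y xy]; first exact: val_inj.
by rewrite /G2 (valP x) (valP y) !andbT (inj_eq val_inj).
Qed.

Theorem complete_graph_routable k (V E : finType) (p : E * bool -> V) :
    6 * k + 6 <= #|V| -> (forall v, #|half_edges p v| <= k.*2) ->
  routable (fun x y => x != y) p.
Proof.
elim: k => [|k IHk] in V E p * => leV deg; first exact: routable_no_half_edges.
(* Demands with equal ends are discarded, as they would be fixed points of the permutation of a
   factor, where the colouring says nothing. *)
pose A e := p (e, true) != p (e, false).
apply: (@routable_restrict _ _ A) => [e|]; first by rewrite negbK => /eqP.
have {}deg v : #|half_edges (fun h : {e | A e} * bool => p (val h.1, h.2)) v| <= k.+1.*2.
  apply: leq_trans (deg v).
  rewrite -(@card_imset _ _ (fun h : {e | A e} * bool => (val h.1, h.2))).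
    by apply/subset_leq_card/subsetP=> _ /imsetP[h hv ->]; move: hv; rewrite !inE.
  by move=> [e b] [f b'] /= [/val_inj -> ->].
have noloop (e : {e | A e}) : p (val e, true) != p (val e, false) := valP e.
have [k0|k_gt0] := posnP k; last exact: (routable_two_factors IHk).
by apply: routable_single_factor => //; [rewrite k0 in leV | rewrite k0 in deg].
Qed.

(** * Grids *)

(** The Cartesian product of [G] with the complete graph on [t] vertices. *)
Definition prod_adj (X : finType) (t : nat) (G : rel X) : rel (X * 'I_t) :=
  fun u v => (u.1 == v.1) && (u.2 != v.2) || (u.2 == v.2) && G u.1 v.1.

Lemma prod_routable (X E : finType) (t h : nat) (G : rel X) (p : E * bool -> X * 'I_t) :
    (forall (E' : finType) (p' : E' * bool -> X),
       (forall x, #|half_edges p' x| <= h.*2) -> routable G p') ->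
    6 * h.*2 + 6 <= t -> (forall v, #|half_edges p v| <= h.*2) ->
  routable (@prod_adj X t G) p.
Proof.
move=> routX leht deg.
have [h0|h_gt0] := posnP h.
  by apply: routable_no_half_edges => v; have := deg v; rewrite h0.
pose pX z := (p z).1.
have degX x : #|half_edges pX x| <= (t * h).*2.
  have := card_fiber_sum (fun z => (p z).2) (half_edges pX x) setT.
  rewrite (_ : [set e in _ | _] = half_edges pX x); last by apply/setP=> z; rewrite !inE andbT.
  move=> ->; have <- : \sum_(a in [set: 'I_t]) h.*2 = (t * h).*2.
    by rewrite sum_nat_const cardsT card_ord doubleMr.
  apply: leq_sum => a _; apply: leq_trans (deg (x, a)).
  apply/subset_leq_card/subsetP=> z; rewrite !inE /pX => /andP[/eqP <- /eqP <-].
  by rewrite -surjective_pairing.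
have [c [o [ck srcI tgtI]]] := two_factorization degX.
have lt_layer e : c e %/ h < t by rewrite ltn_divLR.
pose layer e := Ordinal (lt_layer e).
have deg_layer x l : #|[set z in half_edges pX x | layer z.1 == l]| <= h.*2.
  (* A layer receives [h] consecutive factors, told apart by their index modulo [h]. *)
  pose f (z : E * bool) := (Ordinal (ltn_pmod (c z.1) h_gt0), z.2 == o z.1).
  rewrite -(@card_in_imset _ _ f) => [|z z'].
    by apply: leq_trans (max_card _) _; rewrite card_prod card_ord card_bool muln2.
  rewrite !inE => /andP[/eqP pz /eqP lz] /andP[/eqP pz' /eqP lz'] [cz oz].
  apply: (half_edge_inj srcI tgtI) => //; first by rewrite pz.
  rewrite (divn_eq (c z.1) h) (divn_eq (c z'.1) h) cz; congr (_ * _ + _).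
  by have := lz; rewrite -lz' => -[].
pose pC x (y : {z | (p z).1 == x} * bool) :=
  if y.2 then (p (val y.1)).2 else layer (val y.1).1.
have colR x : routable (fun a b => a != b) (@pC x).
  (* A vertex of the column is the end of at most [h.*2] original half-edges and the layer of at
     most [h.*2] more. *)
  apply: (@complete_graph_routable h.*2); first by rewrite card_ord.
  move=> a; rewrite -[_.*2]addnn.
  have -> : half_edges (@pC x) a = [set y in half_edges (@pC x) a | y.2] :|:
                                   [set y in half_edges (@pC x) a | ~~ y.2].
    by apply/setP=> y; rewrite !inE -andb_orr orbN andbT.
  apply: leq_trans (leq_card_setU _ _).1 (leq_add _ _).
    apply: leq_trans (deg (x, a)).
    rewrite -(@card_in_imset _ _ (fun y : {z | (p z).1 == x} * bool => val y.1)).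
      apply/subset_leq_card/subsetP=> _ /imsetP[[[z zx] b] + ->] /=.
      rewrite !inE /= => /andP[]; case: b => // /eqP <- _; apply/eqP.
      by rewrite /pC /= [LHS]surjective_pairing (eqP zx).
    move=> [y b] [y' b']; rewrite !inE => /andP[_ /= bT] /andP[_ /= bT'] /val_inj ->.
    by case: b b' bT bT' => [] [].
  apply: leq_trans (deg_layer x a).
  rewrite -(@card_in_imset _ _ (fun y : {z | (p z).1 == x} * bool => val y.1)).
    apply/subset_leq_card/subsetP=> _ /imsetP[[[z zx] b] + ->] /=.
    by rewrite !inE /= => /andP[]; case: b => // /eqP <- _; rewrite zx /=.
  move=> [y b] [y' b']; rewrite !inE => /andP[_ /= bT] /andP[_ /= bT'] /val_inj ->.
  by case: b b' bT bT' => [] [].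
have layR l : routable G (fun y : {e | layer e == l} * bool => pX (val y.1, y.2)).
  apply: routX => x; apply: leq_trans (deg_layer x l).
  rewrite -(@card_imset _ _ (fun y : {e | layer e == l} * bool => (val y.1, y.2))).
    apply/subset_leq_card/subsetP=> _ /imsetP[[[e el] b] + ->] /=.
    by rewrite !inE /= => ->; rewrite el.
  by move=> [y b] [y' b'] /= [/val_inj -> ->].
have [oC oCP] := fin_all_exists colR.
have [oL oLP] := fin_all_exists layR.
(* A pair of distinct adjacent vertices lies in a single column or in a single layer, never in
   both. *)
pose owner (T : {set X * 'I_t}) :=
  if [pick x | T \subset [set u | u.1 == x]] is Some x then
    omap (fun y : {z | (p z).1 == x} => (val y).1) (oC x (snd @: T))
  else if [pick l | T \subset [set u | u.2 == l]] is Some l then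
    omap val (oL l (fst @: T))
  else None.
exists owner => e.
have imset2 (A B : finType) (f : A -> B) a b : f @: [set a; b] = [set f a; f b].
  by rewrite imsetU !imset_set1.
have column (z : E * bool) : z.1 = e -> 
    connect (owned_edge (@prod_adj X t G) owner e) (p z) ((p z).1, layer e) /\
    connect (owned_edge (@prod_adj X t G) owner e) ((p z).1, layer e) (p z).
  move=> ze; set x := (p z).1.
  pose y : {z | (p z).1 == x} := exist (fun z => (p z).1 == x) z (eqxx x).
  have := oCP x y; rewrite /pC /= ze => con.
  have step a b : owned_edge (fun a b : 'I_t => a != b) (oC x) y a b ->
      connect (owned_edge (@prod_adj X t G) owner e) (x, a) (x, b).
    move=> /andP[ab /eqP ow]; apply: connect1.
    rewrite /owned_edge /prod_adj eqxx ab /= /owner.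
    case: pickP => [x' /subsetP sub|/(_ x)/negP[]]; last first.
      by apply/subsetP=> u; rewrite !inE => /orP[]/eqP ->; rewrite eqxx.
    have := sub (x, a) (set21 _ _); rewrite inE => /eqP /= eqx; subst x'.
    by rewrite imset2 ow /= ze.
  split; first by rewrite [p z]surjective_pairing; apply: (connect_homo step con).
  rewrite [X in connect _ _ X]surjective_pairing; apply: (connect_homo step).
  by rewrite (sym_connect_sym _) // => a b; rewrite /owned_edge eq_sym setUC.
have [_ colF] := column (e, false) erefl; have [colT _] := column (e, true) erefl.
apply: connect_trans colT (connect_trans _ colF).
pose y : {e' | layer e' == layer e} := exist (fun e' => layer e' == layer e) e (eqxx _).
have := oLP (layer e) y; rewrite /pX /=.
apply: (@connect_homo _ _ _ _ (fun x => (x, layer e))) => x x2 /andP[Gxy /eqP ow].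
(* [G] may be reflexive somewhere, and a singleton would be taken for part of a column. *)
have [->|xy] := eqVneq x x2; first exact: connect0.
apply: connect1; rewrite /owned_edge /prod_adj /= eqxx Gxy orbT /= /owner.
case: pickP => [x' /subsetP sub|_].
  have := sub (x, layer e) (set21 _ _); have := sub (x2, layer e) (set22 _ _).
  by rewrite !inE /= => /eqP e1 /eqP e2; rewrite e1 e2 eqxx in xy.
case: pickP => [l /subsetP sub|/(_ (layer e))/negP[]]; last first.
  by apply/subsetP=> u; rewrite !inE => /orP[]/eqP ->; rewrite eqxx.
have := sub (x, layer e) (set21 _ _); rewrite inE => /eqP /= eql; subst l.
by rewrite imset2 ow.
Qed.

Lemma grid_routable (n t h : nat) (E : finType) (p : E * bool -> grid_vertex n t) :
    6 * h.*2 + 6 <= t -> (forall v, #|half_edges p v| <= h.*2) ->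
  routable (@grid_adj n t) p.
Proof.
move=> leht; elim: n => [|n IHn] in E p *.
  move=> _; exists (fun=> None) => e.
  rewrite (_ : p (e, true) = p (e, false)) ?connect0 //.
  by apply/ffunP=> -[].
move=> deg.
(* The coordinate split off as the second factor of the product is [ord0]. *)
pose f (u : grid_vertex n t * 'I_t) : grid_vertex n.+1 t :=
  [ffun i => if unlift ord0 i is Some j then u.1 j else u.2].
pose g (v : grid_vertex n.+1 t) : grid_vertex n t * 'I_t :=
  ([ffun j => v (lift ord0 j)], v ord0).
have fK : cancel f g.
  move=> [x a]; rewrite /g /f; congr (_, _); last by rewrite ffunE unlift_none.
  by apply/ffunP=> j; rewrite !ffunE liftK.
have gK : cancel g f.
  by move=> v; apply/ffunP=> i; rewrite ffunE; case: unliftP => [j|] -> //=; rewrite ffunE.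
have : routable (@prod_adj _ t (@grid_adj n t)) (g \o p).
  apply: prod_routable leht _ => [E' p'|u]; first exact: IHn.
  apply: leq_trans (deg (f u)); apply/subset_leq_card/subsetP=> z.
  by rewrite !inE /= => /eqP <-; rewrite gK.
have homo u v : prod_adj (@grid_adj n t) u v -> grid_adj (f u) (f v).
  case: u v => [x a] [y b]; rewrite /prod_adj /grid_adj /=.
  case/orP=> [/andP[/eqP -> ab]|/andP[/eqP -> xy]].
    rewrite (_ : [set i | _] = [set ord0]) ?cards1 //.
    apply/setP=> i; rewrite !inE !ffunE; case: unliftP => [j|] -> /=; last by rewrite eqxx.
    by rewrite eqxx.
  rewrite (_ : [set i | _] = lift ord0 @: [set j | x j != y j]).
    by rewrite card_imset //; apply: lift_inj.
  apply/setP=> i; rewrite !inE !ffunE; case: unliftP => [j|] -> /=.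
    by rewrite mem_imset ?inE //; apply: lift_inj.
  by rewrite eqxx; apply/esym/imsetP=> -[j _ /eqP]; rewrite (negPf (neq_lift _ _)).
move=> /(routable_homo (can_inj fK) homo) [o oP].
by exists o => e; have := oP e; rewrite /= !gK.
Qed.

(** * From owners of edges to explicit paths *)

Lemma routable_paths (V E : finType) (G : rel V) (p : E * bool -> V) :
    routable G p ->
  exists P : E -> seq V,
    (forall e, path_joining G [set p (e, true); p (e, false)] (P e)) /\
    (forall e f, e != f -> [disjoint path_edges (P e) & path_edges (P f)]).
Proof.
case=> o oP.
have /fin_all_exists[w wP] e : exists w : seq V,
    [/\ path (owned_edge G o e) (p (e, true)) w, uniq (p (e, true) :: w) &
        p (e, false) = last (p (e, true)) w].
  by have /connectP[w /shortenP[w' pw' uw' _] ->] := oP e; exists w'.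
(* Disjointness follows, since an edge has only one owner. *)
have ownP e S : S \in path_edges (p (e, true) :: w e) -> o S = Some e.
  have [+ _ _] := wP e; rewrite /path_edges => pw /imsetP[[a b]] /=.
  elim: (w e) (p (e, true)) pw => //= y s IHs x /andP[/andP[_ /eqP oxy] ps].
  by rewrite inE => /orP[/eqP[-> ->] ->|]; last exact: IHs.
exists (fun e => p (e, true) :: w e); split=> [e|e f nef].
  have [pw uw ->] := wP e; exists (p (e, true)), (w e); split=> //.
  by apply: sub_path pw => x y /andP[].
apply/pred0P=> S /=; apply: contraNF nef => /andP[/ownP oe /ownP].
by rewrite oe => -[->].
Qed.

Theorem theorem1 (n t q : nat) (hn : 1 <= n) (ht : 1 <= t)
    (q_even : ~~ odd q) (hq : q + 1 <= t %/ 6)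
    (D : multigraph (grid_vertex n t)) (hD : max_degree D <= q) :
  exists P : edge D -> seq (grid_vertex n t),
    (forall e : edge D, path_joining (@grid_adj n t) (ends e) (P e)) /\
    (forall e f : edge D, e != f ->
       [disjoint path_edges (P e) & path_edges (P f)]).
Proof.
have /fin_all_exists[xy xyP] (e : edge D) : exists xy : grid_vertex n t * grid_vertex n t,
    xy.1 != xy.2 /\ ends e = [set xy.1; xy.2].
  by have /eqP/cards2P[x [y [nxy ->]]] := card_ends e; exists (x, y).
pose p (z : edge D * bool) := if z.2 then (xy z.1).1 else (xy z.1).2.
have halfK : q./2.*2 = q by rewrite -[RHS]odd_double_half (negPf q_even).
(* The two ends of an edge are distinct, so at most one half-edge of each edge lies at [v]. *)
have deg v : #|half_edges p v| <= q./2.*2.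
  rewrite halfK; apply: leq_trans hD; apply: leq_trans (leq_bigmax v).
  rewrite -(@card_in_imset _ _ fst) => [|[e b] [f b']].
    apply/subset_leq_card/subsetP=> _ /imsetP[[e b] + ->]; rewrite !inE /p /=.
    by have [_ ->] := xyP e; case: b => /eqP <-; rewrite !inE eqxx ?orbT.
  rewrite !inE /p /= => /eqP ev /eqP fv ef; move: ev fv; rewrite ef.
  have [nxy _] := xyP f; case: b b' => [] [] // <- /eqP;
    by rewrite ?(negPf nxy) // eq_sym (negPf nxy).
(* As [q] is even, this is [6 * (q + 1) <= t]. *)
have leqt : 6 * q./2.*2 + 6 <= t.
  by move: hq; rewrite halfK leq_divRL // addn1 mulnC mulnS addnC.
have [P [Pj Pd]] := routable_paths (grid_routable leqt deg).
by exists P; split=> // e; have [_ ->] := xyP e; apply: Pj.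
Qed.
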